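(* Let $n\ge1$, $d\ge 2$, $R=\mathcal{O}_{\mathbb{P}^n}(1)$ and $L=\mathcal{O}_{\mathbb{P}^n}(d)$ on $\mathbb{P}^n$ over $\mathbb{C}$. (i) Let $m\ge1$ be an integer such that $(n-m)(m+1)<\binom{m+d}{m}$, and assume $d\ge4$. Then $\mathrm{s}^R(u)\ge n-m+1$ for a general $u\in H^0(L)$. (ii) Let $e$ be the maximal dimension of a linear subspace of $\mathbb{P}^n$ contained in a general degree $d$ hypersurface. Then $\mathrm{s}^R(u)\le n-e$ for all nonzero $u\in H^0(L)$, and equality holds for a general $u$.
   Context: For a nonzero homogeneous polynomial $u$ of degree $d$ in $n+1$ variables, the $R$-strength $\mathrm{s}^R(u)$ with $R=\mathcal{O}_{\mathbb{P}^n}(1)$ is the minimal $r$ such that $u=\sum_{i=1}^r\ell_ig_i$ with $\ell_i$ linear forms and $g_i$ homogeneous polynomials of degree $d-1$ ($+\infty$ if none exists). *)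

(* Defs.v *)
From HB Require Import structures.
From mathcomp Require Import all_boot all_order all_algebra.
From mathcomp Require Import complex.
From mathcomp Require Import Rstruct.
From mathcomp Require Import mpoly.



Unset Printing Implicit Defensive.

Import GRing.Theory.
Local Open Scope ring_scope.

Definition CC : numClosedFieldType := (Rdefinitions.R)[i].

Definition mon_idx (n d : nat) : finType := 'X_{1..n.+1 < d.+1}.

Definition coeffs (n d : nat) (u : {mpoly CC[n.+1]}) : 'I_#|{: mon_idx n d}| -> CC :=
  fun i => u@_(bmnm (enum_val i)).

(* A property P holds for a general u in H^0(O_{P^n}(d)) = {degree d forms}:
   P holds on a nonempty Zariski-open subset of the space of degree-d forms,
   i.e. outside the zero locus of a polynomial F in the coefficients that does
   not vanish identically on that space. *)
Definition general (n d : nat) (P : {mpoly CC[n.+1]} -> Prop) : Prop :=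
  exists F : {mpoly CC[#|{: mon_idx n d}|]},
    (exists u0 : {mpoly CC[n.+1]}, u0 \is d.-homog /\ F.@[@coeffs n d u0] != 0) /\
    (forall u : {mpoly CC[n.+1]}, u \is d.-homog -> F.@[@coeffs n d u] != 0 -> P u).

(* u = sum_{i<r} l_i g_i with l_i linear forms and g_i forms of degree d-1;
   s^R(u) <= r iff R_decomp n d u r holds. *)
Definition R_decomp (n d : nat) (u : {mpoly CC[n.+1]}) (r : nat) : Prop :=
  exists (l g : 'I_r -> {mpoly CC[n.+1]}),
    (forall i, l i \is 1.-homog) /\ (forall i, g i \is d.-1.-homog) /\
    u = \sum_(i < r) l i * g i.

Definition is_R_strength (n d : nat) (u : {mpoly CC[n.+1]}) (s : nat) : Prop :=
  R_decomp n d u s /\ forall r, R_decomp n d u r -> (s <= r)%N.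

(* The hypersurface {u = 0} in P^n contains a linear subspace of (projective)
   dimension e: the row space of a rank-(e+1) matrix V, on which u vanishes. *)
Definition contains_linear (n : nat) (u : {mpoly CC[n.+1]}) (e : nat) : Prop :=
  exists V : 'M[CC]_(e.+1, n.+1),
    row_free V /\ forall t : 'rV[CC]_(e.+1), u.@[fun j => (t *m V) 0 j] = 0.

(* Main.v *)
Require Import Defs.
From HB Require Import structures.
From mathcomp Require Import all_boot all_order all_algebra.
From mathcomp Require Import complex.
From mathcomp Require Import Rstruct.
From mathcomp Require Import mpoly.
From mathcomp Require Import zify ring lra.

(* A form is a combination of r linear forms exactly when it vanishes on a linear
   subspace of codimension r, so both parts are about planes in a general
   hypersurface.
   (i) Planes are covered by finitely many charts, as graphs over coordinate planes.
   Straightening the plane by a shear shows that the forms vanishing on some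
   m-plane of a chart are the polynomial image of an affine space of dimension
   (n-m)(m+1) - C(m+d,m) + dim H^0(L) < dim H^0(L), hence satisfy a nontrivial
   polynomial equation.
   (ii) Containing an e-plane is a closed condition by compactness of the
   Grassmannian, made concrete by choosing for each plane a chart whose matrix has
   entries of modulus at most 1; hence every form contains an e-plane. *)

Set Implicit Arguments.
Unset Strict Implicit.
Unset Printing Implicit Defensive.

Import Order.TTheory GRing.Theory Num.Theory.
Local Open Scope ring_scope.

(** * Algebraic dependence *)

Lemma card_bmultinom_le (p K : nat) : (#|{: 'X_{1..p < K}}| <= K ^ p)%N.
Proof.
have lt_m (m : 'X_{1..p < K}) (i : 'I_p) : ((m : 'X_{1..p}) i < K)%N.
  apply: leq_ltn_trans (bmdeg m); rewrite mdegE (bigD1 i) //=; exact: leq_addr.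
rewrite -[K in (K ^ p)%N]card_ord -[p in (_ ^ p)%N]card_ord -card_ffun.
pose h (m : 'X_{1..p < K}) : {ffun 'I_p -> 'I_K} := [ffun i => Ordinal (lt_m m i)].
apply: (@leq_card _ _ h) => m1 m2 /ffunP eq_h.
apply/val_inj/mnmP => i; move: (eq_h i); rewrite !ffunE => /(congr1 val).
by [].
Qed.

Lemma msizeM_leS (K : idomainType) p (P Q : {mpoly K[p]}) a b :
  (msize P <= a.+1)%N -> (msize Q <= b.+1)%N -> (msize (P * Q) <= (a + b).+1)%N.
Proof.
have [->|P0] := eqVneq P 0; first by rewrite mul0r msize0.
have [->|Q0] := eqVneq Q 0; first by rewrite mulr0 msize0.
move=> ha hb; rewrite msizeM //.
rewrite -subn1 leq_subLR add1n -addSn -addnS.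
exact: leq_add.
Qed.

Lemma msize_prodX_le (K : idomainType) p (I : Type) (r : seq I)
    (q : I -> {mpoly K[p]}) (a : I -> nat) D :
  (forall i, msize (q i) <= D.+1)%N ->
  (msize (\prod_(i <- r) q i ^+ a i) <= (\sum_(i <- r) a i * D).+1)%N.
Proof.
move=> hq; elim: r => [|i r IH]; first by rewrite !big_nil msize1.
rewrite !big_cons; apply: msizeM_leS IH.
elim: (a i) => [|k IHk]; first by rewrite expr0 msize1.
by rewrite exprS mulSn; apply: msizeM_leS.
Qed.

Lemma left_kernel_neq0 (K : fieldType) m n (M : 'M[K]_(m, n)) :
  (n < m)%N -> exists2 c : 'rV[K]_m, c != 0 & c *m M = 0.
Proof.
move=> lt_nm; have : kermx M != 0.
  rewrite kermx_eq0 /row_free neq_ltn; apply/orP; left.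
  exact: leq_ltn_trans (rank_leq_col M) lt_nm.
case/rowV0Pn => c /sub_kermxP cM c0; by exists c.
Qed.

(** Since p <= N - 1, the left side is at most (ND+1)^(N-1) (k+1)^(N-1). The first factor is [k] by
    choice, and k (k+1)^(N-1) < (k+1)^N. *)
Lemma box_count_lt N D p (k := ((N * D).+1 ^ N.-1)%N) :
  (p < N)%N -> ((N * (k * D)).+1 ^ p < k.+1 ^ N)%N.
Proof.
case: N @k => // N k lt_pN.
apply: (@leq_ltn_trans ((N.+1 * (k * D)).+1 ^ N)); first by rewrite leq_pexp2l.
apply: (@leq_ltn_trans (((N.+1 * D).+1 * k.+1) ^ N)).
  have le_base : ((N.+1 * (k * D)).+1 <= (N.+1 * D).+1 * k.+1)%N by nia.
  by have [->|N0] := posnP N; rewrite ?expn0 // leq_exp2r.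
by rewrite expnMn [(k.+1 ^ N.+1)%N]expnS ltn_mul2r expn_gt0 /=.
Qed.

(* Box counting: the (k+1)^N products of the q_i with exponents at most k span
   a space of dimension O(k^p), so for k large they are linearly dependent. *)
Lemma algebraic_dependence (K : fieldType) N p (q : 'I_N -> {mpoly K[p]}) :
  (p < N)%N ->
  exists2 F : {mpoly K[N]}, F != 0 & forall v, F.@[fun i => (q i).@[v]] = 0.
Proof.
move=> lt_pN.
pose D := (\max_i msize (q i))%N.
have hD i : (msize (q i) <= D.+1)%N by apply: leqW; apply: leq_bigmax.
pose k := ((N * D).+1 ^ N.-1)%N.
pose B := (N * (k * D)).+1.
pose rT := {ffun 'I_N -> 'I_k.+1}.
pose cT : finType := 'X_{1..p < B}.
pose P (a : rT) : {mpoly K[p]} := \prod_(i <- enum 'I_N) q i ^+ a i.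
have sP a : (msize (P a) <= B)%N.
  apply: leq_trans (msize_prodX_le _ (fun i => nat_of_ord (a i)) hD) _.
  rewrite ltnS big_enum /=.
  apply: (@leq_trans (\sum_(i < N) k * D)).
    by apply: leq_sum => i _; rewrite leq_mul2r -ltnS ltn_ord orbT.
  by rewrite sum_nat_const card_ord.
pose M : 'M[K]_(#|{: rT}|, #|cT|) :=
  \matrix_(i, j) (P (enum_val i))@_(bmnm (enum_val j)).
have [|c c0 cM] := left_kernel_neq0 M.
  apply: leq_ltn_trans (card_bmultinom_le _ _) _.
  by rewrite card_ffun !card_ord; apply: box_count_lt.
pose mon (a : rT) : 'X_{1..N} := [multinom (a i : nat) | i < N].
have mon_inj : injective mon.
  by move=> a b /mnmP e; apply/ffunP => i; apply: val_inj; have := e i; rewrite !mnmE.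
(* The linear relation [c] between the products is read as a polynomial in the [q i]; it is nonzero
   because distinct exponents give distinct monomials. *)
exists (\sum_(i < #|{: rT}|) c 0 i *: 'X_[mon (enum_val i)]).
  apply: contraNneq c0 => F0; apply/eqP/rowP => i.
  have := congr1 (mcoeff (mon (enum_val i))) F0.
  rewrite mcoeff0 mxE => <-; rewrite raddf_sum (bigD1 i) //= mcoeffZ mcoeffX eqxx mulr1.
  rewrite big1 ?addr0 // => j ne_ji; rewrite mcoeffZ mcoeffX.
  by rewrite (inj_eq mon_inj) (inj_eq enum_val_inj) (negPf ne_ji) mulr0.
move=> v.
have PE i : \prod_j (q j).@[v] ^+ mon (enum_val i) j = (P (enum_val i)).@[v].
  rewrite /P big_enum /= rmorph_prod; apply: eq_bigr => j _.
  by rewrite rmorphXn mnmE.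
rewrite raddf_sum; under eq_bigr => i _ do rewrite /= mevalZ mevalX PE -mevalZ.
rewrite -raddf_sum /=.
suff -> : \sum_i c 0 i *: P (enum_val i) = 0 by rewrite meval0.
apply/mpolyP => m; rewrite mcoeff0 raddf_sum /=.
under eq_bigr => i _ do rewrite mcoeffZ.
(* The columns of [M] only see degrees below [B]; higher coefficients vanish by [sP]. *)
have [lt_mB|le_Bm] := ltnP (mdeg m) B.
  have := congr1 (fun A : 'rV_#|cT| => A 0 (enum_rank (BMultinom lt_mB : cT))) cM.
  rewrite /= !mxE => cMm; rewrite -[RHS]cMm; apply: eq_bigr => i _.
  by rewrite mxE enum_rankK.
rewrite big1 // => i _; rewrite [_@_m]memN_msupp_eq0 ?mulr0 //.
by apply: msize_mdeg_ge; apply: leq_trans (sP _) le_Bm.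
Qed.

(** * Polynomial functions *)

(** Fewer than [size Q] points can be roots. The sequence is left free: it is the integers for
    Kronecker substitution, and reciprocals tending to 0 on a line of forms. *)
Lemma poly_nonroot (K : idomainType) (s : nat -> K) (Q : {poly K}) :
  injective s -> Q != 0 -> exists j, Q.[s j] != 0.
Proof.
move=> s_inj Q0.
have [/hasP [j _ Qj]|/hasPn no] := boolP (has (fun j => Q.[s j] != 0) (iota 0 (size Q))).
  by exists j.
have := max_poly_roots (rs := [seq s j | j <- iota 0 (size Q)]) Q0.
rewrite size_map size_iota ltnn => H; exfalso; apply/notF/H.
  by apply/allP => _ /mapP [j /no jQ ->]; apply/negPn.
by rewrite map_inj_uniq ?iota_uniq.
Qed.

Lemma positional_inj B n (a b : nat -> nat) :
    (forall i, a i < B)%N -> (forall i, b i < B)%N ->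
    (\sum_(i < n) a i * B ^ i = \sum_(i < n) b i * B ^ i)%N ->
  forall i, (i < n)%N -> a i = b i.
Proof.
elim: n a b => // n IH a b ha hb.
have shift (c : nat -> nat) : (\sum_(i < n.+1) c i * B ^ i =
               (\sum_(i < n) c i.+1 * B ^ i) * B + c 0)%N.
  rewrite big_ord_recl expn0 muln1 addnC big_distrl /=; congr addn.
  by apply: eq_bigr => i _; rewrite /bump /= add1n expnSr mulnA.
rewrite !shift => e; have B0 : (0 < B)%N by apply: leq_ltn_trans (ha 0%N).
have e0 : a 0%N = b 0%N.
  by have := congr1 (modn^~ B) e; rewrite /= !modnMDl !modn_small.
case=> [|i] // lt_in; apply: (IH (fun i => a i.+1) (fun i => b i.+1)) => //.
by apply/eqP; rewrite -(eqn_pmul2r B0); apply/eqP; lia.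
Qed.

(* Kronecker substitution: x_i := t^(B^i) separates monomials with exponents < B. *)
Lemma meval_neq0 (K : numDomainType) n (P : {mpoly K[n]}) :
  P != 0 -> exists v, P.@[v] != 0.
Proof.
move=> P0; pose B := msize P.
pose h (i : 'I_n) : {poly K} := 'X^(B ^ i).
pose Q : {poly K} := mmap polyC h P.
have monE (m : 'X_{1..n}) :
    mmap1 h m = 'X^(\sum_(i < n) m i * B ^ i).
  rewrite /mmap1 -prodrXr; apply: eq_bigr => i _.
  by rewrite -exprM mulnC.
have ltB m : m \in msupp P -> forall i, (m i < B)%N.
  move=> /msize_mdeg_lt; rewrite -/B => ltm i; apply: leq_ltn_trans ltm.
  by rewrite mdegE (bigD1 i) //= leq_addr.
have Q0 : Q != 0.
  have m0P := mlead_supp P0; set m0 := mlead P in m0P.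
  apply: contraTneq (m0P) => QE.
  rewrite mcoeff_msupp negbK; apply/eqP.
  (* No other monomial of [P] lands on this power, so the leading coefficient survives in [Q]. *)
  have <- : Q`_(\sum_(i < n) m0 i * B ^ i) = P@_m0; last by rewrite QE coef0.
  rewrite /Q /mmap coef_sum (bigD1_seq m0) ?msupp_uniq ?m0P //= monE mul_polyC coefZ coefXn.
  rewrite eqxx mulr1 big1_seq ?addr0 // => m /andP [ne_m mP].
  rewrite monE mul_polyC coefZ coefXn; case: eqP => [e|_]; last by rewrite mulr0.
  case/eqP: ne_m; apply/mnmP => i.
  pose ext (m : 'X_{1..n}) j := if insub j is Some i then m i else 0%N.
  have extE (m' : 'X_{1..n}) (j : 'I_n) : ext m' j = m' j by rewrite /ext valK.
  have ext_lt m' : m' \in msupp P -> forall j, (ext m' j < B)%N.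
    move=> m'P j; rewrite /ext; case: insubP => [? _ _|_]; first exact: ltB.
    exact: leq_ltn_trans (ltB _ m'P i).
  rewrite -!extE; apply: (@positional_inj B n) => //; try exact: ext_lt.
  by under eq_bigr do rewrite extE; rewrite -e; apply: eq_bigr => j _; rewrite extE.
have [j Qj] : exists j : nat, Q.[j%:R] != 0.
  by apply: poly_nonroot Q0 => a b /eqP; rewrite eqr_nat => /eqP.
exists (fun i => j%:R ^+ (B ^ i)); apply: contraNneq Qj => Pj.
rewrite -[0]Pj mevalE /Q /mmap horner_sum; apply/eqP; apply: eq_bigr => m _.
rewrite hornerM hornerC /mmap1 horner_prod; congr (_ * _).
by apply: eq_bigr => i _; rewrite horner_exp hornerXn.
Qed.

Lemma meval_inj (K : numDomainType) n (p q : {mpoly K[n]}) :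
  (forall v, p.@[v] = q.@[v]) -> p = q.
Proof.
move=> e; apply/eqP; rewrite -subr_eq0; apply/negPn/negP => /meval_neq0 [v].
by rewrite mevalB e subrr eqxx.
Qed.

(** * Shears *)

Lemma meval_sum (R : comNzRingType) n (v : 'I_n -> R) (I : Type) (r : seq I)
    (P : pred I) (F : I -> {mpoly R[n]}) :
  (\sum_(i <- r | P i) F i).@[v] = \sum_(i <- r | P i) (F i).@[v].
Proof. exact: (raddf_sum (meval v)). Qed.

(** When [W] vanishes on the columns in the image of [f], the coordinates x_(f i) are fixed and
    negating [W] gives the inverse. The base is any commutative ring, so that the entries of [W] may
    be indeterminates. *)
Definition shear {R : comNzRingType} {k n : nat} (f : 'I_k -> 'I_n)
    (W : 'I_k -> 'I_n -> R) : n.-tuple {mpoly R[n]} :=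
  [tuple 'X_j - \sum_(i < k) W i j *: 'X_(f i) | j < n].

Lemma meval_shear (R : comNzRingType) k n (f : 'I_k -> 'I_n) (W : 'I_k -> 'I_n -> R)
    (p : {mpoly R[n]}) v :
  (p \mPo shear f W).@[v] = p.@[fun j => v j - \sum_(i < k) W i j * v (f i)].
Proof.
rewrite comp_mpoly_meval; apply: meval_eq => j; rewrite tnth_mktuple mevalB mevalXU.
by rewrite meval_sum; under eq_bigr do rewrite mevalZ mevalXU.
Qed.

Lemma shearNK (K : numDomainType) k n (f : 'I_k -> 'I_n) (W : 'I_k -> 'I_n -> K)
    (p : {mpoly K[n]}) :
  (forall i i', W i (f i') = 0) ->
  (p \mPo shear f (fun i j => - W i j)) \mPo shear f W = p.
Proof.
move=> Wf; apply: meval_inj => v; rewrite !meval_shear; apply: meval_eq => j.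
rewrite -[LHS]addrA -opprD -big_split big1 ?subr0 //= => i _.
rewrite big1 ?subr0 ?mulNr ?subrr // => i' _; first by rewrite Wf mul0r.
Qed.

Lemma dhomog_comp (R : idomainType) k n d (p : {mpoly R[k]})
    (lq : k.-tuple {mpoly R[n]}) :
  (forall i, tnth lq i \is 1.-homog) -> p \is d.-homog -> p \mPo lq \is d.-homog.
Proof.
move=> hl hp; rewrite comp_mpolyE; apply: rpred_sum => m _ /=.
have [<-|ne] := eqVneq (mdeg m) d; last first.
  by rewrite (dhomog_nemf_coeff hp) // scale0r rpred0.
rewrite mdegE; apply: rpredZ.
elim/big_rec2: _ => [|i e q _ hq]; first exact: dhomog1.
have := dhomogMn (m i) (hl i); rewrite mul1n => hi; exact: dhomogM hi hq.
Qed.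

Lemma dhomog_shear (K : idomainType) k n d (f : 'I_k -> 'I_n) (W : 'I_k -> 'I_n -> K)
    (p : {mpoly K[n]}) :
  p \is d.-homog -> p \mPo shear f W \is d.-homog.
Proof.
apply: dhomog_comp => i; rewrite tnth_mktuple rpredB //.
  by rewrite dhomogX; apply/eqP/mdeg1.
by apply: rpred_sum => j _; rewrite dhomogZ // dhomogX; apply/eqP/mdeg1.
Qed.

(** These monomials are the ones that survive restriction to the coordinate plane where x_j = 0 for
    all j outside the image of [f]. *)
Definition supported {k n : nat} (f : 'I_k -> 'I_n) (m : 'X_{1..n}) : bool :=
  [forall j, (m j != 0%N) ==> (j \in codom f)].

(* The plane spanned by the rows of V is the graph of x_j = sum_i V_ij x_(f i),
   j outside the image of f, so the shear carries it onto a coordinate plane. *)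
Lemma unshear_supported (K : numFieldType) k n (f : 'I_k -> 'I_n) (V : 'M[K]_(k, n))
    (W := fun i j => if j \in codom f then 0 else V i j) (u : {mpoly K[n]}) :
    colsub f V = 1%:M ->
    (forall t : 'rV[K]_k, u.@[fun j => (t *m V) 0 j] = 0) ->
  forall m, supported f m -> (u \mPo shear f (fun i j => - W i j))@_m = 0.
Proof.
move=> fV uV m fm; set v := u \mPo _.
(* Composing with [r] restricts to the coordinate plane of the chart; there [v] takes the values of
   [u] on the given plane. *)
pose r := [tuple if j \in codom f then 'X_j else 0 : {mpoly K[n]} | j < n].
have Vf i i' : V i (f i') = (i == i')%:R.
  by have := congr1 (fun A : 'M_k => A i i') fV; rewrite !mxE.
have w0 : v \mPo r = 0.
  apply: meval_inj => x; rewrite meval0 comp_mpoly_meval meval_shear.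
  rewrite -[RHS](uV (\row_i x (f i))); apply: meval_eq => j.
  have rf i : (tnth r (f i)).@[x] = x (f i) by rewrite tnth_mktuple codom_f mevalXU.
  rewrite mxE tnth_mktuple; have [/codomP [i0 ->]|jf] := boolP (j \in codom f).
    rewrite mevalXU big1 ?subr0 => [|i _]; last by rewrite /W codom_f oppr0 mul0r.
    rewrite (bigD1 i0) //= mxE Vf eqxx mulr1 big1 ?addr0 // => i ne_i.
    by rewrite Vf (negPf ne_i) mulr0.
  rewrite meval0 sub0r -sumrN; apply: eq_bigr => i _.
  by rewrite rf /W (negPf jf) mxE mulNr opprK mulrC.
have := congr1 (mcoeff m) w0; rewrite mcoeff0 comp_mpolyE raddf_sum /= => <-.
have prodr (m' : 'X_{1..n}) : \prod_(i < n) tnth r i ^+ m' i =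
    if supported f m' then 'X_[m'] else 0.
  case: ifP => [/forallP sup|/negbT].
    rewrite mpolyXE_id; apply: eq_bigr => j _; rewrite tnth_mktuple.
    case: ifP => // jf; have := sup j; rewrite jf implybF negbK => /eqP ->.
    by rewrite !expr0.
  rewrite negb_forall => /existsP [j]; rewrite negb_imply => /andP [mj jf].
  by rewrite (bigD1 j) //= tnth_mktuple (negPf jf) expr0n (negPf mj) mul0r.
under eq_bigr do rewrite mcoeffZ prodr.
have [mv|mv] := boolP (m \in msupp v).
  rewrite (bigD1_seq m) ?msupp_uniq //= fm mcoeffX eqxx mulr1 big1 ?addr0 // => m' ne_m.
  by case: ifP => _; rewrite ?mcoeffX ?(negPf ne_m) ?mcoeff0 mulr0.
rewrite (memN_msupp_eq0 mv) big1_seq // => m' /= m'v.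
have ne_m : m' != m by apply: contraNneq mv => <-.
by case: ifP => _; rewrite ?mcoeffX ?(negPf ne_m) ?mcoeff0 mulr0.
Qed.

(** * Charts of planes *)

(** The two minors differ only in column [i], so expanding the new one along that column involves
    the cofactors of [colsub f V]. *)
Lemma Cramer_colsub (K : fieldType) k n (f : 'I_k -> 'I_n) (V : 'M[K]_(k, n)) i j :
  \det (colsub f V) != 0 ->
  (invmx (colsub f V) *m V) i j =
    \det (colsub (fun i' => if i' == i then j else f i') V) / \det (colsub f V).
Proof.
move=> detA; set A := colsub f V; set A' := colsub _ V.
rewrite /invmx unitmxE unitfE detA -scalemxAl mxE mulrC; congr (_ * _).
rewrite (expand_det_col A' i) mxE; apply: eq_bigr => l _.
rewrite !mxE eqxx mulrC; congr (_ * _); rewrite /cofactor; congr (_ * \det _).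
by apply/matrixP => a b; rewrite !mxE eq_sym (negPf (neq_lift _ _)).
Qed.

Lemma colsub1_inj (K : fieldType) k n (f : 'I_k -> 'I_n) (V : 'M[K]_(k, n)) :
  colsub f V = 1%:M -> injective f.
Proof.
move=> fV i i' e.
have := congr1 (fun A : 'M_k => (A i i, A i i')) fV; rewrite !mxE e eqxx => -[->].
by case: eqP => // _ /eqP; rewrite oner_eq0.
Qed.

(* Normalizing by a k x k minor of largest modulus, Cramer's rule bounds every
   entry by a quotient of minors, hence by 1. *)
Lemma bounded_chart (K : numFieldType) k n (V : 'M[K]_(k, n)) :
  row_free V ->
  exists (f : {ffun 'I_k -> 'I_n}) (M : 'M[K]_k),
    colsub f (M *m V) = 1%:M /\ forall i j, `|(M *m V) i j| <= 1.
Proof.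
move=> Vfree; have VTfull : row_full V^T by rewrite /row_full mxrank_tr.
have [f0 Hf0] : exists f0 : {ffun 'I_k -> 'I_n}, \det (colsub f0 V) != 0.
  exists [ffun i => fullrankfun VTfull i].
  rewrite -unitfE -unitmxE -unitmx_tr.
  suff -> : (colsub [ffun i => fullrankfun VTfull i] V)^T =
            rowsub (fullrankfun VTfull) V^T by exact: fullrowsub_unit.
  by apply/matrixP => i j; rewrite !mxE ffunE.
pose F (f : {ffun 'I_k -> 'I_n}) := `|\det (colsub f V)|.
(* [K] is only partially ordered; the maximum exists because norms are real. *)
have [f _ fmax] := @real_arg_maxP K _ f0 predT F isT (fun i _ => normr_real _).
have detf : \det (colsub f V) != 0.
  by rewrite -normr_gt0; apply: lt_le_trans (fmax f0 isT); rewrite normr_gt0.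
exists f, (invmx (colsub f V)); split.
  have -> : colsub f (invmx (colsub f V) *m V) = invmx (colsub f V) *m colsub f V.
    by apply/matrixP => i j; rewrite !mxE; apply: eq_bigr => l _; rewrite !mxE.
  by rewrite mulVmx // unitmxE unitfE.
move=> i j; rewrite Cramer_colsub // normrM normfV ler_pdivrMr ?normr_gt0 // mul1r.
have := fmax [ffun i' => if i' == i then j else f i'] isT; rewrite /F.
suff -> : colsub [ffun i' => if i' == i then j else f i'] V =
  colsub (fun i' => if i' == i then j else f i') V by [].
by apply/matrixP => a b; rewrite !mxE ffunE.
Qed.

Lemma contains_linear_chart n (u : {mpoly CC[n.+1]}) e :
  contains_linear n u e ->
  exists (f : {ffun 'I_e.+1 -> 'I_n.+1}) (V : 'M[CC]_(e.+1, n.+1)),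
    [/\ colsub f V = 1%:M, forall i j, `|V i j| <= 1 &
        forall t : 'rV[CC]_(e.+1), u.@[fun j => (t *m V) 0 j] = 0].
Proof.
case=> V [/bounded_chart [f [M [fV Vle]]] uV].
exists f, (M *m V); split => // t; rewrite mulmxA; exact: uV.
Qed.

Lemma chart_contains_linear n (u : {mpoly CC[n.+1]}) e (f : 'I_e.+1 -> 'I_n.+1)
    (V : 'M[CC]_(e.+1, n.+1)) :
  colsub f V = 1%:M ->
  (forall t : 'rV[CC]_(e.+1), u.@[fun j => (t *m V) 0 j] = 0) ->
  contains_linear n u e.
Proof.
move=> fV uV; exists V; split => //; apply/row_freeP.
exists (\matrix_(j, i) (j == f i)%:R); rewrite -fV.
apply/matrixP => a b; rewrite !mxE (bigD1 (f b)) //= !mxE eqxx mulr1 big1 ?addr0 //.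
by move=> j ne_j; rewrite mxE (negPf ne_j) mulr0.
Qed.

(** * Decompositions of a form and planes in its hypersurface *)

Lemma comp_mpolyM (R : comNzRingType) k n (lq : k.-tuple {mpoly R[n]}) (p q : {mpoly R[k]}) :
  (p * q) \mPo lq = (p \mPo lq) * (q \mPo lq).
Proof. exact: (rmorphM (comp_mpoly lq)). Qed.

Lemma card_predC_codom k n (f : 'I_k -> 'I_n) :
  injective f -> #|[predC codom f]| = (n - k)%N.
Proof.
move=> f_inj; have h : (k + #|[predC codom f]| = n)%N.
  by have := cardC (mem (codom f)); rewrite card_codom // !card_ord.
by rewrite -[in RHS]h addKn.
Qed.

(** Once the plane is straightened, every monomial of the form is divisible by one of the n - e
    variables outside the chart. Grouping monomials by such a variable and shearing back turns these
    variables into the linear forms. *)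
Lemma contains_linear_R_decomp n d (u : {mpoly CC[n.+1]}) e :
  u \is d.-homog -> contains_linear n u e -> R_decomp n d u (n - e).
Proof.
move=> ud /contains_linear_chart [f [V [fV _ uV]]].
have f_inj := colsub1_inj fV.
have card_f : #|[predC codom f]| = (n - e)%N.
  by rewrite card_predC_codom // subSS.
pose J (i : 'I_(n - e)) := enum_val (cast_ord (esym card_f) i).
pose W i j := if j \in codom f then 0 else V i j.
have Wf i i' : W i (f i') = 0 by rewrite /W codom_f.
pose v := u \mPo shear f (fun i j => - W i j).
have vd : v \is d.-homog by apply: dhomog_shear.
(* One divisor is selected per monomial, so that each monomial is counted exactly once. *)
pose divisor (m : 'X_{1..n.+1}) := [pick i | m (J i) != 0%N].
have divisor_some m : m \in msupp v -> exists i, divisor m = Some i.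
  rewrite mcoeff_msupp /divisor; case: pickP => [i _|no]; first by exists i.
  rewrite (unshear_supported fV uV) ?eqxx //.
  apply/forallP => j; rewrite implybE orbC; case: (boolP (j \in codom f)) => //= jf.
  have jC : j \in [predC codom f] by [].
  have := no (cast_ord card_f (enum_rank_in jC j)).
  by rewrite /J cast_ordK enum_rankK_in // => ->.
have divisorE m i : divisor m = Some i -> (m - U_(J i) + U_(J i))%MM = m.
  by rewrite /divisor; case: pickP => // i' mi [<-]; rewrite submK // lep1mP.
pose l (i : 'I_(n - e)) := tnth (shear f W) (J i).
pose g (i : 'I_(n - e)) : {mpoly CC[n.+1]} := \sum_(m <- msupp v | divisor m == Some i)
  v@_m *: ('X_[m - U_(J i)] \mPo shear f W).
exists l, g; split; [|split].
- move=> i; have : 'X_(J i) \is [in CC[n.+1], 1.-homog].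
    by rewrite dhomogX; apply/eqP/mdeg1.
  by move=> /(dhomog_shear f W); rewrite comp_mpolyXU -tnth_nth.
- move=> i; rewrite /g big_seq_cond; apply: rpred_sum => m /andP [mv /eqP hm].
  rewrite rpredZ // dhomog_shear // dhomogX.
  have : mdeg m = d := dhomog_mf vd mv.
  rewrite -{1}(divisorE _ _ hm).
  by rewrite mdegD mdeg1 addn1 => <-.
rewrite -{1}(shearNK u Wf) -/v comp_mpolyEX.
have lgE i : l i * g i =
    \sum_(m <- msupp v | divisor m == Some i) v@_m *: ('X_[m] \mPo shear f W).
  rewrite /g mulr_sumr; apply: eq_bigr => m /eqP hm.
  rewrite -scalerAr mulrC; congr (_ *: _).
  rewrite -{2}(divisorE _ _ hm) mpolyXD comp_mpolyM.
  by rewrite comp_mpolyXU -tnth_nth.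
under [RHS]eq_bigr do rewrite lgE.
rewrite [RHS](exchange_big_dep predT) //= [LHS]big_seq [RHS]big_seq.
apply: eq_bigr => m /divisor_some [i mi].
rewrite (big_pred1 i) // => i'; rewrite mi.
by apply/eqP/eqP => [[->]|->].
Qed.

Lemma meval_linear_form (R : comNzRingType) n (l : {mpoly R[n]}) x :
  l \is 1.-homog -> l.@[x] = \sum_j l@_U_(j) * x j.
Proof.
move=> l1; have lE : l = \sum_j l@_U_(j) *: 'X_j.
  apply/mpolyP => m; rewrite raddf_sum; have [/mdeg1P [i /eqP ->]|ne] := boolP (mdeg m == 1%N).
    rewrite (bigD1 i) //= mcoeffZ mcoeffX eqxx mulr1 big1 ?addr0 // => j ne_ji.
    rewrite mcoeffZ mcoeffX; case: eqP => [/mnmP /(_ i)|_]; last by rewrite mulr0.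
    by rewrite !mnm1E eqxx (negPf ne_ji).
  rewrite (dhomog_nemf_coeff l1 ne) big1 // => j _ /=; rewrite mcoeffZ mcoeffX.
  case: eqP => [mE|_]; last by rewrite mulr0.
  by rewrite -mE mdeg1 in ne.
by rewrite {1}lE meval_sum; apply: eq_bigr => j _; rewrite mevalZ mevalXU.
Qed.

(** The common zeros of [r] linear forms have dimension at least n + 1 - r >= e + 1 as a vector
    space, and [u] vanishes on them; [e.+1] rows of a basis give the plane. *)
Lemma R_decomp_contains_linear n d (u : {mpoly CC[n.+1]}) r e :
  R_decomp n d u r -> (r + e <= n)%N -> contains_linear n u e.
Proof.
case=> [l [g [l1 [_ ->]]]] le_n.
pose L : 'M[CC]_(n.+1, r) := \matrix_(j, i) (l i)@_U_(j).
pose B := row_base (kermx L).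
have le_rk : (e.+1 <= \rank (kermx L))%N.
  by rewrite mxrank_ker; have := rank_leq_col L; lia.
exists (pid_mx e.+1 *m B); split.
  rewrite /row_free mxrankMfree ?row_base_free // rank_pid_mx ?eqxx //.
move=> t; rewrite meval_sum big1 // => i _; rewrite mevalM meval_linear_form //.
have BL : B *m L = 0.
  by apply/sub_kermxP; rewrite eq_row_base.
have := congr1 (fun A : 'rV_r => A 0 i) (congr1 (mulmx (t *m pid_mx e.+1)) BL).
rewrite mulmx0 mulmxA [RHS]mxE mxE => tL.
rewrite -[X in X * _]/(_) (_ : \sum_j _ = 0) ?mul0r // -[RHS]tL.
by apply: eq_bigr => j _; rewrite mulmxA [L j i]mxE mulrC.
Qed.

(** * Counting monomials in the coordinates of a chart *)

Definition form_monomials (n d : nat) : {set mon_idx n d} :=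
  [set x : mon_idx n d | mdeg (bmnm x) == d].

(** Moving exponents along [f] embeds the degree [d] monomials in m + 1 variables into the supported
    ones. *)
Lemma card_supported n m d (f : 'I_m.+1 -> 'I_n.+1) :
  injective f ->
  ('C(m + d, m) <= #|[set x in form_monomials n d | supported f (bmnm x)]|)%N.
Proof.
move=> f_inj.
pose g (a : 'X_{1..m.+1}) : 'X_{1..n.+1} := [multinom \sum_(i | f i == j) a i | j < n.+1].
have gf a i : g a (f i) = a i.
  rewrite mnmE (big_pred1 i) // => i'; exact: (inj_eq f_inj).
have g_inj : injective g.
  by move=> a b e; apply/mnmP => i; rewrite -!gf e.
have g_deg a : mdeg (g a) = mdeg a.
  rewrite !mdegE; under eq_bigr do rewrite mnmE.
  rewrite (exchange_big_dep predT) //=; apply: eq_bigr => i _.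
  by rewrite (big_pred1 (f i)) // => j; rewrite eq_sym.
have g_sup a : supported f (g a).
  apply/forallP => j; apply/implyP; apply: contraR => jf.
  rewrite mnmE big1 // => i /eqP fi; by rewrite -fi codom_f in jf.
rewrite -bin_sub ?leq_addr // addKn addnC -size_basis -(size_map g).
set S := [set x in _ | _].
rewrite cardE -(size_map (@bmnm n.+1 d.+1)).
apply: uniq_leq_size; first by rewrite (map_inj_uniq g_inj) uniq_basis.
move=> _ /mapP [a ha ->]; move: ha; rewrite -basis_cover => /eqP ad.
have lt_d : (mdeg (g a) < d.+1)%N by rewrite g_deg ad.
apply/mapP; exists (BMultinom lt_d) => //.
by rewrite mem_enum !inE /= g_deg ad eqxx g_sup.
Qed.

(** * Equations for forms containing a plane *)

(** A plane in the chart is given by its matrix entries outside the identity block ([inl]), and a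
    form vanishing on it by the coefficients of its straightening at unsupported monomials
    ([inr]). *)
Definition shear_parameters n d m (f : 'I_m.+1 -> 'I_n.+1) :
    {set 'I_m.+1 * 'I_n.+1 + mon_idx n d} :=
  [set z | match z with
           | inl ij => ij.2 \notin codom f
           | inr x => (x \in form_monomials n d) && ~~ supported f (bmnm x)
           end].

(** The plane adds (m+1)(n-m) parameters, while vanishing on it removes at least C(m+d,m)
    coefficients. *)
Lemma card_shear_parameters n d m (f : 'I_m.+1 -> 'I_n.+1) :
  injective f -> (m <= n)%N -> ((n - m) * m.+1 < 'C(m + d, m))%N ->
  (#|shear_parameters d f| < #|form_monomials n d|)%N.
Proof.
move=> f_inj le_mn count.
pose S := [set x in form_monomials n d | supported f (bmnm x)].
have leS := card_supported d f_inj; rewrite -/S in leS.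
pose A1 := setX [set: 'I_m.+1] [set j | j \notin codom f].
have card_A1 : #|A1| = (m.+1 * (n - m))%N.
  rewrite cardsX cardsT card_ord; congr muln.
  have -> : #|[set j | j \notin codom f]| = #|[predC codom f]|.
    by apply: eq_card => j; rewrite !inE.
  by rewrite card_predC_codom // subSS.
have sub : shear_parameters d f \subset
    (inl @: A1) :|: (inr @: (form_monomials n d :\: S)).
  apply/subsetP => -[ij|x]; rewrite !inE.
    by move=> hij; rewrite imset_f // !inE.
  case/andP => hx sx; apply/orP; right; apply: imset_f.
  by rewrite !inE hx (negPf sx).
have SsubF : S \subset form_monomials n d by apply/subsetP => x; rewrite inE => /andP [].
apply: leq_ltn_trans (subset_leq_card sub) _.
apply: leq_ltn_trans (leq_card_setU _ _).1 _.
apply: leq_ltn_trans (leq_add (leq_imset_card _ _) (leq_imset_card _ _)) _.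
rewrite cardsDS // card_A1 mulnC.
have leSF := subset_leq_card SsubF.
rewrite -[X in (_ < X)%N](subnKC leSF) ltn_add2r.
exact: leq_trans count leS.
Qed.

(* The forms vanishing on a plane of the chart f are the images of the
   polynomials without monomial supported in the chart under a shear; these
   depend on fewer parameters than there are coefficients. *)
Lemma chart_equation n d m (f : 'I_m.+1 -> 'I_n.+1) :
  injective f -> (m <= n)%N -> ((n - m) * m.+1 < 'C(m + d, m))%N ->
  exists2 F : {mpoly CC[#|form_monomials n d|]}, F != 0 &
    forall (u : {mpoly CC[n.+1]}) (V : 'M[CC]_(m.+1, n.+1)),
      u \is d.-homog -> colsub f V = 1%:M ->
      (forall t : 'rV[CC]_(m.+1), u.@[fun j => (t *m V) 0 j] = 0) ->
      F.@[fun k => u@_(bmnm (enum_val k))] = 0.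
Proof.
move=> f_inj le_mn count.
pose A := shear_parameters d f.
(* par z is the indeterminate of index z, and 0 when z is not in A *)
pose par z : {mpoly CC[#|A|]} := \sum_(k < #|A| | enum_val k == z) 'X_k.
have parE (h : 'I_m.+1 * 'I_n.+1 + mon_idx n d -> CC) z :
    (par z).@[fun k => h (enum_val k)] = if z \in A then h z else 0.
  rewrite meval_sum; case: ifP => zA.
    rewrite (big_pred1 (enum_rank_in zA z)) => [|k].
      by rewrite mevalXU enum_rankK_in.
    apply/eqP/eqP => [kz|->]; last exact: enum_rankK_in.
    by apply: enum_val_inj; rewrite enum_rankK_in.
  rewrite big1 // => k /eqP kz; have := enum_valP k; by rewrite kz zA.
(* The generic form of the family: its coefficients are polynomials in the parameters, and these are
   algebraically dependent by the count. *)
pose Q : {mpoly {mpoly CC[#|A|]}[n.+1]} :=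
  \sum_(x : mon_idx n d) par (inr x) *: ('X_[bmnm x] \mPo shear f (fun i j => par (inl (i, j)))).
have [F F0 FQ] := algebraic_dependence (fun k => Q@_(bmnm (enum_val k)))
                    (card_shear_parameters f_inj le_mn count).
exists F => // u V ud fV uV.
pose W i j := if j \in codom f then 0 else V i j.
have Wf i i' : W i (f i') = 0 by rewrite /W codom_f.
pose v := u \mPo shear f (fun i j => - W i j).
have vd : v \is d.-homog by apply: dhomog_shear.
pose h (z : 'I_m.+1 * 'I_n.+1 + mon_idx n d) : CC :=
  match z with inl ij => V ij.1 ij.2 | inr x => v@_(bmnm x) end.
pose w (k : 'I_#|A|) : CC := h (enum_val k).
have parw z : (par z).@[w] = if z \in A then h z else 0 by exact: (parE h z).
suff QE : map_mpoly (meval w) Q = u.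
  rewrite -[RHS](FQ w); apply: meval_eq => k.
  by rewrite -[in LHS]QE mcoeff_map_mpoly.
rewrite -[RHS](shearNK u Wf) -/v.
rewrite (comp_mpolywE _ (w := d.+1)); last first.
  rewrite msizeE; apply/bigmax_leqP_seq => x xv _.
  by rewrite ltnS (dhomog_mf vd xv).
rewrite rmorph_sum; apply: eq_bigr => x _ /=.
rewrite map_mpolyZ comp_mpolyX rmorph_prod; congr (_ *: _).
  (* Off the parameter set [par] is 0, in agreement with [v]: other degrees vanish by homogeneity,
     supported monomials by straightening. *)
  rewrite [LHS](parw (inr x)).
  rewrite !inE /=; case: eqP => [_|ne] /=; last first.
    by rewrite (dhomog_nemf_coeff vd) //; apply/eqP.
  by case: ifP => // /negbT; rewrite negbK => sx; rewrite (unshear_supported fV uV).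
apply: eq_bigr => j _; rewrite rmorphXn; congr (_ ^+ _).
rewrite !tnth_mktuple rmorphB rmorph_sum /= map_mpolyX; congr (_ - _).
apply: eq_bigr => i _; rewrite map_mpolyZ map_mpolyX; congr (_ *: _).
rewrite [LHS](parw (inl (i, j))) inE /W.
by case: (j \in codom f).
Qed.

(** Every plane lies in one of finitely many charts, so the product of the chart equations vanishes
    on all forms containing a plane, and it is nonzero in a domain. *)
Lemma general_not_contains_linear n d m :
  (m <= n)%N -> ((n - m) * m.+1 < 'C(m + d, m))%N ->
  general n d (fun u => ~ contains_linear n u m).
Proof.
move=> le_mn count.
have /fin_all_exists [F hF] (f : {ffun 'I_m.+1 -> 'I_n.+1}) :
    exists F : {mpoly CC[#|form_monomials n d|]}, F != 0 /\
      forall (u : {mpoly CC[n.+1]}) (V : 'M[CC]_(m.+1, n.+1)),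
        u \is d.-homog -> colsub f V = 1%:M ->
        (forall t : 'rV[CC]_(m.+1), u.@[fun j => (t *m V) 0 j] = 0) ->
        F.@[fun k => u@_(bmnm (enum_val k))] = 0.
  have [/injectiveP f_inj|f_ninj] := boolP (injectiveb f).
    by have [F F0 FV] := chart_equation f_inj le_mn count; exists F.
  (* A non-injective [f] is the chart of no plane, so the equation 1 is correct vacuously. *)
  exists 1; split=> [|u V _ fV _]; first exact: oner_neq0.
  by case/injectiveP: f_ninj; apply: colsub1_inj fV.
pose G := \prod_f F f.
have G0 : G != 0 by apply/prodf_neq0 => f _; case: (hF f).
have [v Gv] := meval_neq0 G0.
pose mon (k : 'I_#|form_monomials n d|) : 'X_{1..n.+1} := bmnm (enum_val k).
(* [general] uses coefficients in all degrees up to [d]; [emb] views an equation in those of degree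
   [d] as one in all of them. *)
pose emb := [tuple 'X_(enum_rank (enum_val k)) : {mpoly CC[#|{: mon_idx n d}|]}
              | k < #|form_monomials n d|].
have embE u : (G \mPo emb).@[@coeffs n d u] = G.@[fun k => u@_(mon k)].
  rewrite comp_mpoly_meval; apply: meval_eq => k.
  by rewrite tnth_mktuple mevalXU /coeffs enum_rankK.
have mon_deg k : mdeg (mon k) = d.
  by have := enum_valP k; rewrite inE => /eqP.
have mon_inj : injective mon by move=> a b /val_inj /enum_val_inj.
exists (G \mPo emb); split.
  exists (\sum_k v k *: 'X_[mon k]); split.
    apply: rpred_sum => k _; rewrite rpredZ // dhomogX.
    by apply/eqP/mon_deg.
  rewrite embE (meval_eq (v2 := v)) // => k.
  rewrite raddf_sum (bigD1 k) //= mcoeffZ mcoeffX eqxx mulr1 big1 ?addr0 // => i ne_ik.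
  by rewrite mcoeffZ mcoeffX (inj_eq mon_inj) (negPf ne_ik) mulr0.
move=> u ud; rewrite embE => Gu /contains_linear_chart [f [V [fV _ uV]]].
case/eqP: Gu; rewrite /G rmorph_prod (bigD1 f) //= [X in X * _](_ : _ = 0) ?mul0r //.
by have [_ FV] := hF f; exact: FV ud fV uV.
Qed.

(** * Limits of complex sequences *)

(** In [CC] the condition [0 < e] makes [e] a positive real, so one definition serves real and
    complex sequences. *)
Definition tends (K : numDomainType) (a : nat -> K) (l : K) : Prop :=
  forall e, 0 < e -> exists k0, forall k, (k0 <= k)%N -> `|a k - l| < e.

Lemma tends_cst (K : numDomainType) (l : K) : tends (fun _ => l) l.
Proof. by move=> e e0; exists 0%N => k _; rewrite subrr normr0. Qed.

Lemma eq_tends (K : numDomainType) (a b : nat -> K) l : a =1 b -> tends a l -> tends b l.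
Proof. by move=> ab al e /al [N hN]; exists N => k /hN; rewrite ab. Qed.

Lemma tends_unique (K : numFieldType) (a : nat -> K) l l' : tends a l -> tends a l' -> l = l'.
Proof.
move=> al al'; apply/eqP; rewrite -subr_eq0 -normr_le0; apply/negPn/negP => ne.
have d0 : 0 < `|l - l'| / 2.
  rewrite divr_gt0 ?ltr0n //; rewrite normr_gt0; apply: contra ne => /eqP ->.
  by rewrite normr0.
have [N hN] := al _ d0; have [N' hN'] := al' _ d0.
have := ltrD (hN _ (leq_maxl N N')) (hN' _ (leq_maxr N N')).
rewrite -splitr distrC => h; have := le_lt_trans (ler_normD _ _) h.
by rewrite addrA subrK ltxx.
Qed.

Lemma tends_comp (K : numDomainType) (a : nat -> K) l (phi : nat -> nat) :
  (forall k, (k <= phi k)%N) -> tends a l -> tends (a \o phi) l.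
Proof.
by move=> le_phi al e /al [N hN]; exists N => k leNk; apply/hN/(leq_trans leNk).
Qed.

Lemma tendsD (K : numFieldType) (a b : nat -> K) l m :
  tends a l -> tends b m -> tends (fun k => a k + b k) (l + m).
Proof.
move=> al bm e e0; have e2 : 0 < e / 2 by rewrite divr_gt0 ?ltr0n.
have [N hN] := al _ e2; have [N' hN'] := bm _ e2.
exists (maxn N N') => k; rewrite geq_max => /andP [/hN h /hN' h'].
by rewrite opprD addrACA [e]splitr; apply: le_lt_trans (ler_normD _ _) (ltrD h h').
Qed.

Lemma tendsM (K : numFieldType) (a b : nat -> K) l m :
  tends a l -> tends b m -> tends (fun k => a k * b k) (l * m).
Proof.
move=> al bm e e0.
(* With both errors below e/c <= 1, the product is off by at most (e/c)(1 + |l| + |m|); the summand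
   [e] gives both e/c <= 1 and the strict inequality. *)
pose c := 1 + `|l| + `|m| + e.
have c0 : 0 < c by rewrite ltr_wpDl // !addr_ge0.
have d0 : 0 < e / c by rewrite divr_gt0.
have [N hN] := al _ d0; have [N' hN'] := bm _ d0.
exists (maxn N N') => k; rewrite geq_max => /andP [/hN h /hN' h'].
have d1 : e / c <= 1 by rewrite ler_pdivrMr // mul1r lerDr !addr_ge0.
have -> : a k * b k - l * m = (a k - l) * (b k - m) + (l * (b k - m) + (a k - l) * m).
  by ring.
apply: (@le_lt_trans _ _ (e / c + (`|l| * (e / c) + e / c * `|m|))).
  apply: le_trans (ler_normD _ _) _; apply: lerD.
    rewrite normrM -[leRHS]mulr1; apply: ler_pM => //; first exact: ltW.
    exact: le_trans (ltW h') d1.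
  apply: le_trans (ler_normD _ _) _; rewrite !normrM; apply: lerD.
    by rewrite ler_wpM2l // ltW.
  by rewrite ler_wpM2r // ltW.
have -> : e / c + (`|l| * (e / c) + e / c * `|m|) = e * ((1 + `|l| + `|m|) / c) by ring.
by rewrite -[ltRHS]mulr1 ltr_pM2l // ltr_pdivrMr // mul1r ltrDl.
Qed.

Lemma tends_sum (K : numFieldType) (I : Type) (r : seq I) (a : nat -> I -> K) l :
  (forall i, tends (fun k => a k i) (l i)) ->
  tends (fun k => \sum_(i <- r) a k i) (\sum_(i <- r) l i).
Proof.
move=> al; elim: r => [|i r IH].
  by rewrite big_nil; apply: eq_tends (tends_cst 0) => k; rewrite big_nil.
by rewrite big_cons; apply: eq_tends (tendsD (al i) IH) => k; rewrite big_cons.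
Qed.

Lemma tends_prodX (K : numFieldType) (I : Type) (r : seq I) (a : nat -> I -> K) l (m : I -> nat) :
  (forall i, tends (fun k => a k i) (l i)) ->
  tends (fun k => \prod_(i <- r) a k i ^+ m i) (\prod_(i <- r) l i ^+ m i).
Proof.
move=> al; elim: r => [|i r IH].
  by rewrite big_nil; apply: eq_tends (tends_cst 1) => k; rewrite big_nil.
rewrite big_cons; have aX j : tends (fun k => a k i ^+ j) (l i ^+ j).
  elim: j => [|j IHj]; first by apply: eq_tends (tends_cst 1).
  by rewrite exprS; apply: eq_tends (tendsM (al i) IHj) => k; rewrite exprS.
by apply: eq_tends (tendsM (aX (m i)) IH) => k; rewrite big_cons.
Qed.

Lemma tends_meval (K : numFieldType) n (p : {mpoly K[n]}) (a : nat -> 'I_n -> K) l :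
  (forall i, tends (fun k => a k i) (l i)) -> tends (fun k => p.@[a k]) p.@[l].
Proof.
move=> al; rewrite mevalE; apply: eq_tends (fun k => esym (mevalE (a k) p)) _.
by apply: tends_sum => m; apply: tendsM (tends_cst _) _; apply: tends_prodX.
Qed.

Notation RR := Rdefinitions.R.

Lemma tends_complex (a : nat -> CC) (l : CC) :
  tends (fun k => complex.Re (a k)) (complex.Re l) ->
  tends (fun k => complex.Im (a k)) (complex.Im l) -> tends a l.
Proof.
move=> al bm e e0.
have eE : e = ((complex.Re e)%:C)%C by rewrite RRe_real // gtr0_real.
have r0 : 0 < complex.Re e by rewrite -ltcR -eE.
have r2 : 0 < complex.Re e / 2 by rewrite divr_gt0 ?ltr0n.
have [K hK] := al _ r2; have [K' hK'] := bm _ r2.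
exists (maxn K K') => k; rewrite geq_max => /andP [/hK h /hK' h'].
rewrite eE normc_def ltcR -(ger0_norm (ltW r0)) -sqrtr_sqr ltr_sqrt ?exprn_gt0 //.
rewrite !raddfB /= -(real_normK (num_real (complex.Re (a k) - _))).
rewrite -(real_normK (num_real (complex.Im (a k) - _))).
move: h h' r0 (normr_ge0 (complex.Re (a k) - complex.Re l))
  (normr_ge0 (complex.Im (a k) - complex.Im l)).
set x := `|_|; set y := `|_|; set r := complex.Re e => h h' r0 x0 y0.
nra.
Qed.

Lemma eventually_inv_lt (e : RR) :
  0 < e -> exists K, forall k, (K <= k)%N -> k.+1%:R^-1 < e.
Proof.
move=> e0; have e1 : 0 <= e^-1 by rewrite invr_ge0 ltW.
exists (Num.bound e^-1) => k le_k.
rewrite -[ltRHS]invrK ltf_pV2 ?posrE ?invr_gt0 ?ltr0n //.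
apply: lt_le_trans (archi_boundP e1) _.
by rewrite ler_nat ltnW.
Qed.

Lemma tends_inv0 (a : nat -> CC) : (forall k, `|a k| <= k.+1%:R^-1) -> tends a 0.
Proof.
move=> ha e e0.
have eE : e = ((complex.Re e)%:C)%C by rewrite RRe_real // gtr0_real.
have [|K hK] := @eventually_inv_lt (complex.Re e); first by rewrite -ltcR -eE.
exists K => k /hK; rewrite subr0 -ltcR -eE fmorphV rmorph_nat.
exact: le_lt_trans (ha k).
Qed.

(** Bolzano-Weierstrass gives a cluster point. Extraction is encoded by k <= phi k, which is stable
    under composition and preserves limits. *)
Lemma bounded_subsequence_real (a : nat -> RR) :
  (forall k, `|a k| <= 1) ->
  exists (phi : nat -> nat) l, (forall k, (k <= phi k)%N) /\ tends (a \o phi) l.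
Proof.
move=> a1.
have [|l hl] := Rtopology.Bolzano_Weierstrass a _ (Rtopology.compact_P3 (-1) 1).
  move=> k; have := a1 k; rewrite ler_norml => /andP [h1 h2].
  by split; apply/RleP.
have near k : exists p, (k <= p)%N /\ `|a p - l| < k.+1%:R^-1.
  have /RltP k0 : 0 < k.+1%:R^-1 :> RR by rewrite invr_gt0 ltr0n.
  have [|p [/ssrnat.leP le_p hp]] := hl (Rtopology.disc l (RIneq.mkposreal _ k0)) k.
    by exists (RIneq.mkposreal _ k0).
  by exists p; split=> //; move: hp; rewrite /Rtopology.disc RabsE => /RltP.
have [phi hphi] := boolp.choice near.
exists phi, l; split=> [k|]; first by case: (hphi k).
move=> e /eventually_inv_lt [K hK]; exists K => k /hK.
by apply: lt_trans; case: (hphi k).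
Qed.

Lemma norm_Re_Im_le1 (z : CC) : `|z| <= 1 -> `|complex.Re z| <= 1 /\ `|complex.Im z| <= 1.
Proof.
rewrite normc_def -(rmorph1 (real_complex RR)) lecR -[X in _ <= X]sqrtr1.
rewrite ler_sqrt ?ltr01 // => h; rewrite !ler_norml; nra.
Qed.

Lemma bounded_subsequence (a : nat -> CC) :
  (forall k, `|a k| <= 1) ->
  exists (phi : nat -> nat) l, (forall k, (k <= phi k)%N) /\ tends (a \o phi) l.
Proof.
move=> a1.
have [phi [x [le_phi hx]]] := bounded_subsequence_real (fun k => (norm_Re_Im_le1 (a1 k)).1).
have [psi [y [le_psi hy]]] :=
  bounded_subsequence_real (fun k => (norm_Re_Im_le1 (a1 (phi k))).2).
exists (phi \o psi), (x +i* y)%C; split=> [k|].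
  exact: leq_trans (le_psi k) (le_phi _).
apply: tends_complex => //; exact: tends_comp le_psi hx.
Qed.

(** Extraction proceeds one coordinate at a time; a further extraction keeps the limits already
    found. *)
Lemma bounded_subsequence_fin (T : finType) (a : nat -> T -> CC) :
  (forall k t, `|a k t| <= 1) ->
  exists (phi : nat -> nat) (l : T -> CC), (forall k, (k <= phi k)%N) /\
    forall t, tends (fun k => a (phi k) t) (l t).
Proof.
move=> a1.
suff [phi [le_phi hphi]] : exists phi : nat -> nat, (forall k, (k <= phi k)%N) /\
    forall t, t \in enum T -> exists l, tends (fun k => a (phi k) t) l.
  have /fin_all_exists [l hl] t : exists l, tends (fun k => a (phi k) t) l.
    by apply: hphi; rewrite mem_enum.
  by exists phi, l.
elim: (enum T) => [|t s [phi [le_phi IH]]]; first by exists id.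
have [psi [l [le_psi hl]]] := bounded_subsequence (fun k => a1 (phi k) t).
exists (phi \o psi); split=> [k|t'].
  exact: leq_trans (le_psi k) (le_phi _).
rewrite inE => /predU1P [->|/IH [l' hl']]; first by exists l.
by exists l'; apply: tends_comp le_psi hl'.
Qed.

(** Pigeonhole: if every value stopped occurring at some index, none would be left at the largest of
    these indices. *)
Lemma infinitely_often (T : finType) (c : nat -> T) :
  exists (t : T) (phi : nat -> nat), (forall k, (k <= phi k)%N) /\ forall k, c (phi k) = t.
Proof.
have [t ht] : exists t, forall k, exists p, (k <= p)%N /\ c p = t.
  apply: boolp.contrapT => no.
  have /fin_all_exists [K hK] t : exists K, forall p, (K <= p)%N -> c p <> t.
    apply: boolp.contrapT => noK; apply: no; exists t => k.
    apply: boolp.contrapT => nop; apply: noK; exists k => p lekp cp; apply: nop.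
    by exists p.
  by apply: (hK (c (\max_t K t)) (\max_t K t)) => //; apply: leq_bigmax.
have [phi hphi] := boolp.choice ht.
by exists t, phi; split=> k; case: (hphi k).
Qed.

(** * Degeneration of planes *)

(* On the line from u to a general form u0, all but finitely many points contain
   an e-plane; normalized charts let these planes converge as the point tends to u. *)
Lemma contains_linear_general n d e (P : {mpoly CC[n.+1]} -> Prop) :
  (forall u, P u -> contains_linear n u e) -> general n d P ->
  forall u : {mpoly CC[n.+1]}, u \is d.-homog -> contains_linear n u e.
Proof.
move=> Pe [F [[u0 [u0d Fu0]] FP]] u ud.
(* [F] along the line from [u] to [u0]; it is nonzero because its value at 1 is that of [F] at
   [u0]. *)
pose Q : {poly CC} := mmap polyC
  (fun i => (@coeffs n d u i)%:P + (@coeffs n d (u0 - u) i)%:P * 'X) F.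
have QE t : Q.[t] = F.@[@coeffs n d (u + t *: (u0 - u))].
  rewrite mevalE /Q /mmap horner_sum; apply: eq_bigr => m _.
  rewrite hornerM hornerC /mmap1 horner_prod; congr (_ * _).
  apply: eq_bigr => i _; rewrite horner_exp !hornerE; congr (_ ^+ _).
  by rewrite /coeffs [in RHS]mcoeffD mcoeffZ mulrC.
have Q0 : Q != 0.
  apply: contraNneq Fu0 => Q0; have := QE 1.
  by rewrite Q0 horner0 scale1r addrC subrK => <-.
have close k : exists t : CC, `|t| <= k.+1%:R^-1 /\ contains_linear n (u + t *: (u0 - u)) e.
  (* The shift by [k] keeps every candidate parameter within 1/(k+1) of 0. *)
  have [|j Qj] := @poly_nonroot _ (fun j => (j + k).+1%:R^-1) _ _ Q0.
    move=> a b /invr_inj /eqP; rewrite eqr_nat eqSS eqn_add2r => /eqP; exact.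
  exists (j + k).+1%:R^-1; split.
    rewrite ger0_norm ?invr_ge0 ?ler0n // lef_pV2 ?posrE ?ltr0n //.
    by rewrite ler_nat ltnS leq_addl.
  apply/Pe/FP; last by rewrite -QE.
  by rewrite rpredD // rpredZ // rpredB.
have [t ht] := boolp.choice close.
have chart k : exists fV : {ffun 'I_e.+1 -> 'I_n.+1} * 'M[CC]_(e.+1, n.+1),
    [/\ colsub fV.1 fV.2 = 1%:M, forall i j, `|fV.2 i j| <= 1 &
        forall x : 'rV[CC]_(e.+1),
          (u + t k *: (u0 - u)).@[fun j => (x *m fV.2) 0 j] = 0].
  by have [_ /contains_linear_chart [f [V hV]]] := ht k; exists (f, V).
have [fV hfV] := boolp.choice chart.
(* One chart is fixed along a subsequence, then the bounded matrices converge entrywise; the limit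
   keeps the identity block, hence full rank. *)
have [f [phi [le_phi fphi]]] := infinitely_often (fun k => (fV k).1).
have [|psi [V [le_psi hV]]] :=
    @bounded_subsequence_fin _ (fun k (ij : 'I_e.+1 * 'I_n.+1) => (fV (phi k)).2 ij.1 ij.2).
  by move=> k ij; case: (hfV (phi k)).
pose s k := phi (psi k).
have le_s k : (k <= s k)%N by apply: leq_trans (le_psi k) (le_phi _).
have t0 : tends (fun k => t (s k)) 0.
  by apply: (@tends_comp _ t _ s) le_s _; apply: tends_inv0 => k; case: (ht k).
apply: (@chart_contains_linear _ _ _ f (\matrix_(i, j) V (i, j))).
  apply/matrixP => i j; rewrite !mxE.
  apply: tends_unique (hV (i, f j)) _; apply: eq_tends (tends_cst _) => k /=.
  have [fV1 _ _] := hfV (s k).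
  have := congr1 (fun A : 'M_e.+1 => A i j) fV1; rewrite !mxE => <-.
  by rewrite fphi.
move=> x.
have xV j : tends (fun k => (x *m (fV (s k)).2) 0 j) ((x *m \matrix_(i, j) V (i, j)) 0 j).
  rewrite mxE; apply: eq_tends (fun k => esym (mxE _ _ _ _)) _.
  apply: tends_sum => i; apply: tendsM (tends_cst _) _.
  by rewrite mxE; apply: (hV (i, j)).
(* On the planes of the sequence [u] equals -t (u0 - u), which tends to 0 with t. *)
apply: tends_unique (tends_meval u xV) _.
have := tendsM t0 (tends_meval (u0 - u) xV); rewrite mul0r => h.
have := tendsM (tends_cst (-1)) h; rewrite mulr0; apply: eq_tends => k.
have [_ _ uV] := hfV (s k); have := uV x; rewrite mevalD mevalZ => /eqP.
by rewrite addr_eq0 mulN1r => /eqP ->.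
Qed.

Theorem theorem5p5 (n d : nat) (hn : (1 <= n)%N) (hd : (2 <= d)%N) :
  (* (i) *)
  (forall m : nat, (1 <= m)%N ->
     ((n%:Z - m%:Z) * (m%:Z + 1) < ('C(m + d, m))%:Z)%R ->
     (4 <= d)%N ->
     general n d (fun u => forall r : nat, R_decomp n d u r ->
                           (n%:Z - m%:Z + 1 <= r%:Z)%R)) /\
  (* (ii) *)
  (forall e : nat,
     general n d (fun u => contains_linear n u e /\ ~ contains_linear n u e.+1) ->
     (forall u : {mpoly CC[n.+1]}, u \is d.-homog -> u != 0 ->
        exists r : nat, (r <= n - e)%N /\ R_decomp n d u r) /\
     general n d (fun u => is_R_strength n d u (n - e))).
Proof.
split=> [m _ count _|e gen].
  have [le_mn|lt_nm] := leqP m n.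
    rewrite subzn // -PoszD -PoszM ltz_nat addn1 in count.
    have [F [u0 FP]] := general_not_contains_linear le_mn count.
    exists F; split => // u ud Fu r ur.
    (* At most n - m linear forms would leave an m-plane of common zeros. *)
    have [le_rmn|] := leqP (r + m) n; last by lia.
    by case: (FP u ud Fu); apply: R_decomp_contains_linear ur le_rmn.
  (* For m > n the bound n - m + 1 is at most 0, so every form qualifies. *)
  exists 1; split=> [|u _ _ r _]; last by lia.
  by exists 0; rewrite dhomog0 meval1 oner_neq0.
have all_e := contains_linear_general (fun u => @proj1 _ _) gen.
split=> [u ud _|].
  by exists (n - e)%N; split; last exact: contains_linear_R_decomp ud (all_e u ud).
have [F [u0 FP]] := gen; exists F; split => // u ud Fu.
have [ue une] := FP u ud Fu.
split=> [|r ur]; first exact: contains_linear_R_decomp.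
(* A shorter decomposition has r + (e + 1) <= n and would put an (e+1)-plane in the hypersurface. *)
rewrite leqNgt; apply/negP => lt_r; apply: une.
by apply: R_decomp_contains_linear ur _; lia.
Qed.
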